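(* Let $\mathrm{k}$ be a field. 1) Let $A$ be a DG algebra over $\mathrm{k}$, and $a\in H^0(A)$ a nilpotent element. Then the corresponding morphism $f:\mathrm{k}[x]\to A$ (where $|x|=0$) in $\operatorname{Ho}(\operatorname{dgalg}_{\mathrm{k}})$ factors through $\mathrm{k}[x]/x^n$ for a sufficiently large $n$. 2) If moreover $a^2=0$ in $H^0(A)$, then it suffices to take $n=6$.
   Context: $\operatorname{Ho}(\operatorname{dgalg}_{\mathrm{k}})$ is the homotopy category of (unital, associative) DG algebras over $\mathrm{k}$, i.e. with quasi-isomorphisms inverted. The algebra $\mathrm{k}[x]$ has $x$ in degree $0$ and zero differential; the morphism corresponding to $a$ is the one with $H^0(f)(x)=a$ (obtained by sending $x$ to a cocycle representing $a$). ''Factors through $\mathrm{k}[x]/x^n$'' means: $f$ equals, in $\operatorname{Ho}(\operatorname{dgalg}_{\mathrm{k}})$, the composition of the projection $\mathrm{k}[x]\to \mathrm{k}[x]/x^n$ with some morphism $\mathrm{k}[x]/x^n\to A$. *)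

(* Defs.v *)
From HB Require Import structures.
From mathcomp Require Import all_boot all_algebra.
From mathcomp Require Import boolp.

Set Implicit Arguments.
Unset Strict Implicit.
Unset Printing Implicit Defensive.

Import GRing.Theory.
Local Open Scope ring_scope.
Local Open Scope quotient_scope.

(* Unital associative k-algebras; the zero algebra, which the library's
   [algType] excludes, is allowed. *)
Record kalg (k : fieldType) := KAlg {
  kalg_ring : pzRingType;
  kalg_scale : k -> kalg_ring -> kalg_ring;
  kalg_scaleA : forall c d a,
    kalg_scale c (kalg_scale d a) = kalg_scale (c * d) a;
  kalg_scale1 : left_id 1 kalg_scale;
  kalg_scaleDr : right_distributive kalg_scale +%R;
  kalg_scaleDl : forall a, {morph kalg_scale^~ a : c d / c + d};
  kalg_scaleAl : forall c a b, kalg_scale c (a * b) = kalg_scale c a * b;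
  kalg_scaleAr : forall c a b, kalg_scale c (a * b) = a * kalg_scale c b
}.

Definition kalg_sort (k : fieldType) (A : kalg k) : Type := kalg_ring A.
Coercion kalg_sort : kalg >-> Sortclass.

HB.instance Definition _ (k : fieldType) (A : kalg k) :=
  GRing.PzRing.on (kalg_sort A).
HB.instance Definition _ (k : fieldType) (A : kalg k) :=
  GRing.Zmodule_isLmodule.Build k (kalg_sort A)
    (@kalg_scaleA k A) (@kalg_scale1 k A) (@kalg_scaleDr k A)
    (@kalg_scaleDl k A).

(* The carrier is the direct sum of the graded components, and [dgc i] is the
   projection onto the summand of degree i.  The grading is cohomological. *)
Record dgAlg (k : fieldType) := DGAlg {
  dg_alg :> kalg k;
  dgc : int -> dg_alg -> dg_alg;
  dgc_linear : forall i, linear (dgc i);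
  dgc_dgc : forall i j a, dgc i (dgc j a) = if i == j then dgc j a else 0;
  dgc_sum : forall a, exists s : seq int,
    uniq s /\ a = \sum_(i <- s) dgc i a;
  dgc_one : dgc 0 1 = 1;
  dgc_mul : forall i j a b,
    dgc i a = a -> dgc j b = b -> dgc (i + j) (a * b) = a * b;
  dgd : dg_alg -> dg_alg;
  dgd_linear : linear dgd;
  dgc_dgd : forall i a, dgc i a = a -> dgc (i + 1) (dgd a) = dgd a;
  dgd_dgd : forall a, dgd (dgd a) = 0;
  dgd_leibniz : forall i a b, dgc i a = a ->
    dgd (a * b) = dgd a * b + (-1) ^+ `|i|%N * (a * dgd b)
}.

HB.instance Definition _ (k : fieldType) (A : dgAlg k) (i : int) :=
  GRing.isLinear.Build k A A *:%R (@dgc k A i) (@dgc_linear k A i).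
HB.instance Definition _ (k : fieldType) (A : dgAlg k) :=
  GRing.isLinear.Build k A A *:%R (@dgd k A) (@dgd_linear k A).

Definition homog (k : fieldType) (A : dgAlg k) (i : int) (a : A) : Prop :=
  dgc i a = a.

Record dg_mor (k : fieldType) (A B : dgAlg k) := DGMor {
  dgm_fun :> A -> B;
  dgm_linear : linear dgm_fun;
  dgm_monoid : monoid_morphism dgm_fun;
  dgm_dgc : forall i a, dgm_fun (dgc i a) = dgc i (dgm_fun a);
  dgm_dgd : forall a, dgm_fun (dgd a) = dgd (dgm_fun a)
}.

HB.instance Definition _ (k : fieldType) (A B : dgAlg k)
    (f : dg_mor A B) :=
  GRing.isLinear.Build k A B *:%R (dgm_fun f) (dgm_linear f).
HB.instance Definition _ (k : fieldType) (A B : dgAlg k)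
    (f : dg_mor A B) :=
  GRing.isMonoidMorphism.Build A B (dgm_fun f) (dgm_monoid f).

Lemma dg_mor_ext (k : fieldType) (A B : dgAlg k) (f g : dg_mor A B) :
  f =1 g -> f = g.
Proof.
case: f g => [f fl fm fc fd] [g gl gm gc gd] /= /funext fg.
move: fl fm fc fd; rewrite fg => fl fm fc fd.
by rewrite (Prop_irrelevance fl gl) (Prop_irrelevance fm gm)
  (Prop_irrelevance fc gc) (Prop_irrelevance fd gd).
Qed.

Definition dg_id (k : fieldType) (A : dgAlg k) : dg_mor A A.
Proof. by exists id => //; split. Defined.

Definition dg_comp (k : fieldType) (A B C : dgAlg k)
  (g : dg_mor B C) (f : dg_mor A B) : dg_mor A C.
Proof.
exists (g \o f) => /=.
- by move=> c a b /=; rewrite !linearP.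
- by split=> [|a b] /=; rewrite ?rmorph1 ?rmorphM.
- by move=> i a /=; rewrite !dgm_dgc.
- by move=> a /=; rewrite !dgm_dgd.
Defined.

Section Cohomology.
Variables (k : fieldType) (A : dgAlg k).

Definition is_cocycle (n : int) (a : A) : bool :=
  `[< homog n a /\ dgd a = 0 >].

Lemma is_cocycleP n a : reflect (homog n a /\ dgd a = 0) (is_cocycle n a).
Proof. exact: asboolP. Qed.

Fact is_cocycle_zmod n : zmod_closed (is_cocycle n).
Proof.
split=> [|a b /is_cocycleP[ha da] /is_cocycleP[hb db]]; apply/is_cocycleP.
  by rewrite /homog !linear0.
by rewrite /homog !linearB /= ha hb da db subr0.
Qed.

HB.instance Definition _ n :=
  GRing.isZmodClosed.Build A (is_cocycle n) (is_cocycle_zmod n).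

Record cocycle (n : int) := Cocycle {
  cocycle_val :> A;
  cocycle_valP : cocycle_val \in is_cocycle n
}.

HB.instance Definition _ n := [isSub for @cocycle_val n].
HB.instance Definition _ n := [Choice of cocycle n by <:].
HB.instance Definition _ n := [SubChoice_isSubZmodule of cocycle n by <:].

Definition is_coboundary (n : int) (z : cocycle n) : bool :=
  `[< exists y : A, homog (n - 1) y /\ val z = dgd y >].

Lemma is_coboundaryP n (z : cocycle n) :
  reflect (exists y : A, homog (n - 1) y /\ val z = dgd y) (is_coboundary z).
Proof. exact: asboolP. Qed.

Fact is_coboundary_zmod n : zmod_closed (@is_coboundary n).
Proof.
split=> [|z w /is_coboundaryP[a [ha da]] /is_coboundaryP[b [hb db]]];
  apply/is_coboundaryP.
  by exists 0; rewrite /homog !linear0.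
by exists (a - b); rewrite /homog !linearB /= ha hb -da -db.
Qed.

HB.instance Definition _ n :=
  GRing.isZmodClosed.Build (cocycle n) (@is_coboundary n)
    (@is_coboundary_zmod n).

Definition coboundary (n : int) : zmodClosed (cocycle n) :=
  GRing.ZmodClosed.clone (cocycle n) (@is_coboundary n) _.

Definition cohom (n : int) := Quotient.quot (coboundary n).
HB.instance Definition _ n := GRing.Zmodule.on (cohom n).

Definition cclass n (z : cocycle n) : cohom n := \pi_(cohom n) z.

Lemma cclass_eq n (z w : cocycle n) :
  cclass z = cclass w <-> is_coboundary (z - w).
Proof.
rewrite -[is_coboundary _]/(z - w \in @is_coboundary n) Quotient.idealrBE.
by split=> [/eqP|/eqP].
Qed.

Lemma cclass_repr n (a : cohom n) : cclass (repr a) = a.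
Proof. exact: reprK. Qed.

End Cohomology.

Section CohomologyRing.
Variables (k : fieldType) (A : dgAlg k).

Fact cocycle_one_subproof : (1 : A) \in is_cocycle 0.
Proof.
apply/is_cocycleP; split; first exact: dgc_one.
have := dgd_leibniz (1 : A) (dgc_one A).
rewrite mulr1 mul1r expr0 mul1r => /eqP.
by rewrite mulr1 -subr_eq subrr => /eqP<-.
Qed.

Fact cocycle_mul_subproof (z w : cocycle A 0) :
  (val z * val w) \in is_cocycle 0.
Proof.
case: z w => [z /is_cocycleP[hz dz]] [w /is_cocycleP[hw dw]] /=.
apply/is_cocycleP; split; first by have := dgc_mul hz hw; rewrite addr0.
by rewrite (dgd_leibniz _ hz) dz dw !(mul0r, mulr0, addr0).
Qed.

Definition cocycle_one : cocycle A 0 := Cocycle cocycle_one_subproof.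
Definition cocycle_mul (z w : cocycle A 0) : cocycle A 0 :=
  Cocycle (cocycle_mul_subproof z w).

Definition H0 := cohom A 0.
HB.instance Definition _ := GRing.Zmodule.on H0.

Definition H0_one : H0 := cclass cocycle_one.
Definition H0_mul (a b : H0) : H0 := cclass (cocycle_mul (repr a) (repr b)).

Lemma H0_mulE (z w : cocycle A 0) :
  H0_mul (cclass z) (cclass w) = cclass (cocycle_mul z w).
Proof.
rewrite /H0_mul; set z' := repr _; set w' := repr _.
have /cclass_eq/is_coboundaryP[y [hy zy]] : cclass z' = cclass z.
  exact: cclass_repr.
have /cclass_eq/is_coboundaryP[u [hu wu]] : cclass w' = cclass w.
  exact: cclass_repr.
apply/cclass_eq/is_coboundaryP.
have [hz dz] := is_cocycleP _ _ (cocycle_valP z).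
have [hw' dw'] := is_cocycleP _ _ (cocycle_valP w').
exists (y * val w' + val z * u); split.
  rewrite /homog linearD /=; congr (_ + _).
    by have := dgc_mul hy hw'; rewrite addr0.
  by have := dgc_mul hz hu; rewrite add0r.
rewrite linearD /= (dgd_leibniz _ hy) (dgd_leibniz _ hz) dz dw' -zy -wu /=.
by rewrite !mulr0 addr0 mul0r add0r expr0 mul1r mulrBl mulrBr addrA subrK.
Qed.

Fact H0_mulA : associative H0_mul.
Proof.
move=> a b c; rewrite -[a]cclass_repr -[b]cclass_repr -[c]cclass_repr.
by rewrite !H0_mulE; congr cclass; apply: val_inj; rewrite /= mulrA.
Qed.

Fact H0_mul1l : left_id H0_one H0_mul.
Proof.
move=> a; rewrite -[a]cclass_repr H0_mulE.
by congr cclass; apply: val_inj; rewrite /= mul1r.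
Qed.

Fact H0_mul1r : right_id H0_one H0_mul.
Proof.
move=> a; rewrite -[a]cclass_repr H0_mulE.
by congr cclass; apply: val_inj; rewrite /= mulr1.
Qed.

Lemma cclassD n (z w : cocycle A n) : cclass (z + w) = cclass z + cclass w.
Proof. exact: (raddfD \pi_(cohom A n)). Qed.

Fact H0_mulDl : left_distributive H0_mul +%R.
Proof.
move=> a b c; rewrite -[a]cclass_repr -[b]cclass_repr -[c]cclass_repr.
rewrite -cclassD !H0_mulE -cclassD.
by congr cclass; apply: val_inj; rewrite /= mulrDl.
Qed.

Fact H0_mulDr : right_distributive H0_mul +%R.
Proof.
move=> a b c; rewrite -[a]cclass_repr -[b]cclass_repr -[c]cclass_repr.
rewrite -cclassD !H0_mulE -cclassD.
by congr cclass; apply: val_inj; rewrite /= mulrDr.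
Qed.

HB.instance Definition _ := GRing.Zmodule_isPzRing.Build H0
  H0_mulA H0_mul1l H0_mul1r H0_mulDl H0_mulDr.

End CohomologyRing.

Section CohomologyMap.
Variables (k : fieldType) (A B : dgAlg k) (f : dg_mor A B).

Fact cocycle_map_subproof n (z : cocycle A n) : f (val z) \in is_cocycle n.
Proof.
have [hz dz] := is_cocycleP _ _ (cocycle_valP z).
by apply/is_cocycleP; rewrite /homog -dgm_dgc -dgm_dgd hz dz linear0.
Qed.

Definition cocycle_map n (z : cocycle A n) : cocycle B n :=
  Cocycle (cocycle_map_subproof z).

Definition cohom_map n (a : cohom A n) : cohom B n :=
  cclass (cocycle_map (repr a)).

Lemma cohom_mapE n (z : cocycle A n) :
  cohom_map (cclass z) = cclass (cocycle_map z).
Proof.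
have /cclass_eq/is_coboundaryP[y [hy zy]] :
  cclass (repr (cclass z)) = cclass z by exact: cclass_repr.
apply/cclass_eq/is_coboundaryP; exists (f y); split.
  by rewrite /homog -dgm_dgc hy.
by rewrite -dgm_dgd -zy /= linearB.
Qed.

Definition quasi_iso : Prop := forall n, bijective (@cohom_map n).

End CohomologyMap.

(* Ho(dgalg_k) as the Gabriel-Zisman localization: morphisms are formal
   composites of DG morphisms and formal inverses of quasi-isomorphisms, and
   [ho_eq] is the congruence that defines their equality. *)
Inductive ho_mor (k : fieldType) : dgAlg k -> dgAlg k -> Type :=
| ho_of (A B : dgAlg k) : dg_mor A B -> ho_mor A B
| ho_inv (A B : dgAlg k) (w : dg_mor A B) : quasi_iso w -> ho_mor B A
| ho_comp (A B C : dgAlg k) : ho_mor B C -> ho_mor A B -> ho_mor A C.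

Inductive ho_eq (k : fieldType) :
    forall A B : dgAlg k, ho_mor A B -> ho_mor A B -> Prop :=
| ho_refl (A B : dgAlg k) (f : ho_mor A B) : ho_eq f f
| ho_sym (A B : dgAlg k) (f g : ho_mor A B) : ho_eq f g -> ho_eq g f
| ho_trans (A B : dgAlg k) (f g h : ho_mor A B) :
    ho_eq f g -> ho_eq g h -> ho_eq f h
| ho_congr (A B C : dgAlg k) (g g' : ho_mor B C) (f f' : ho_mor A B) :
    ho_eq g g' -> ho_eq f f' -> ho_eq (ho_comp g f) (ho_comp g' f')
| ho_assoc (A B C D : dgAlg k)
    (h : ho_mor C D) (g : ho_mor B C) (f : ho_mor A B) :
    ho_eq (ho_comp h (ho_comp g f)) (ho_comp (ho_comp h g) f)
| ho_idl (A B : dgAlg k) (f : ho_mor A B) :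
    ho_eq (ho_comp (ho_of (dg_id B)) f) f
| ho_idr (A B : dgAlg k) (f : ho_mor A B) :
    ho_eq (ho_comp f (ho_of (dg_id A))) f
| ho_of_comp (A B C : dgAlg k) (g : dg_mor B C) (f : dg_mor A B) :
    ho_eq (ho_of (dg_comp g f)) (ho_comp (ho_of g) (ho_of f))
| ho_inv_l (A B : dgAlg k) (w : dg_mor A B) (qw : quasi_iso w) :
    ho_eq (ho_comp (ho_inv qw) (ho_of w)) (ho_of (dg_id A))
| ho_inv_r (A B : dgAlg k) (w : dg_mor A B) (qw : quasi_iso w) :
    ho_eq (ho_comp (ho_of w) (ho_inv qw)) (ho_of (dg_id B)).

Section InDegree0.
Variables (k : fieldType) (R : algType k).

Definition kalg_of_alg : kalg k :=
  @KAlg k R *:%R (@scalerA k R) (@scale1r k R) (@scalerDr k R)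
    (@scalerDl k R) (@scalerAl k R) (@scalerAr k R).

Local Notation C := kalg_of_alg.
Let comp (i : int) (a : C) : C := if i == 0 then a else 0.
Let d (a : C) : C := 0.

Fact in_degree0_comp_linear i : linear (comp i).
Proof. by move=> c a b; rewrite /comp; case: ifP; rewrite ?scaler0 ?addr0. Qed.

Fact in_degree0_comp_comp i j a :
  comp i (comp j a) = if i == j then comp j a else 0.
Proof.
rewrite /comp; have [->|ij] := eqVneq i j; first by case: (j == 0).
case: (eqVneq j 0) => [j0|_]; last by case: (i == 0).
by rewrite -j0 (negPf ij).
Qed.

Fact in_degree0_sum a : exists s : seq int,
  uniq s /\ a = \sum_(i <- s) comp i a.
Proof. by exists [:: 0]; rewrite big_seq1. Qed.

Fact in_degree0_one : comp 0 1 = 1.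
Proof. by []. Qed.

Fact in_degree0_mul i j a b :
  comp i a = a -> comp j b = b -> comp (i + j) (a * b) = a * b.
Proof.
rewrite /comp; case: (eqVneq i 0) => [->|_ <- _]; last first.
  by rewrite mul0r; case: ifP.
case: (eqVneq j 0) => [->|_ _ <-]; first by rewrite addr0.
by rewrite mulr0; case: ifP.
Qed.

Fact in_degree0_d_linear : linear d.
Proof. by move=> c a b; rewrite /d scaler0 addr0. Qed.

Fact in_degree0_comp_d i a : comp i a = a -> comp (i + 1) (d a) = d a.
Proof. by rewrite /comp /d; case: (i + 1 == 0). Qed.

Fact in_degree0_dd a : d (d a) = 0.
Proof. by []. Qed.

Fact in_degree0_leibniz i a b : comp i a = a ->
  d (a * b) = d a * b + (-1) ^+ `|i|%N * (a * d b).
Proof. by rewrite /d mul0r !mulr0 addr0. Qed.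

Definition in_degree0 : dgAlg k := @DGAlg k C comp
  in_degree0_comp_linear in_degree0_comp_comp in_degree0_sum in_degree0_one
  in_degree0_mul d in_degree0_d_linear in_degree0_comp_d in_degree0_dd
  in_degree0_leibniz.

End InDegree0.

Section Truncated.
Variable k : fieldType.

Definition kx : dgAlg k := in_degree0 {poly k}.

(* [{poly %/ 'X^n}] is k[x]/x^n for n > 0 only; for n = 0 the library
   makes it k[x]/x. *)
Definition kxn (n : nat) : dgAlg k := in_degree0 {poly %/ ('X^n : {poly k})}.

Definition kx_proj (n : nat) : dg_mor kx (kxn n).
Proof.
exists (in_qpoly ('X^n : {poly k})).
- exact: in_qpoly_is_linear.
- exact: in_qpoly_monoid_morphism.
- by move=> i a; rewrite /dgc /=; case: ifP => // _; apply: in_qpoly0.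
- by move=> a; apply: in_qpoly0.
Defined.

Fact kx_var_subproof : ('X : kx) \in is_cocycle 0.
Proof. by apply/is_cocycleP. Qed.

Definition kx_var : cocycle kx 0 := Cocycle kx_var_subproof.

Section KxMor.
Variables (A : dgAlg k) (z : cocycle A 0).

Definition kx_eval (p : kx) : A :=
  \sum_(i < size (p : {poly k})) (p : {poly k})`_i *: cocycle_val z ^+ i.

Lemma kx_evalE n (p : {poly k}) : (size p <= n)%N ->
  kx_eval p = \sum_(i < n) p`_i *: cocycle_val z ^+ i.
Proof.
move=> pn; rewrite [RHS](big_ord_widen_cond n.+1 xpredT
  (fun i => p`_i *: cocycle_val z ^+ i)) // /kx_eval.
rewrite (big_ord_widen_cond n.+1 xpredT
  (fun i => p`_i *: cocycle_val z ^+ i)) ?(leq_trans pn) //=.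
rewrite big_mkcond [RHS]big_mkcond /=; apply: eq_bigr => i _.
case: ltnP => hi; first by rewrite (leq_trans hi pn).
by rewrite nth_default // scale0r; case: ifP.
Qed.

Fact kx_eval_linear : linear kx_eval.
Proof.
move=> c p q.
set n := maxn (size (p : {poly k})) (size (q : {poly k})).
have hp : (size (p : {poly k}) <= n)%N by exact: leq_maxl.
have hq : (size (q : {poly k}) <= n)%N by exact: leq_maxr.
have hpq : (size (c *: (p : {poly k}) + q)%R <= n)%N.
  rewrite (leq_trans (size_polyD _ _)) // geq_max hq andbT.
  exact: leq_trans (size_scale_leq _ _) hp.
rewrite (kx_evalE hp) (kx_evalE hq) (kx_evalE hpq) scaler_sumr -big_split /=.
by apply: eq_bigr => i _; rewrite coefD coefZ scalerDl scalerA.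
Qed.

HB.instance Definition _ :=
  GRing.isLinear.Build k kx A *:%R kx_eval kx_eval_linear.

Lemma kx_evalXn i : kx_eval ('X^i : {poly k}) = cocycle_val z ^+ i.
Proof.
rewrite (@kx_evalE i.+1) ?size_polyXn // big_ord_recr /= big1 ?add0r.
  by rewrite coefXn eqxx scale1r.
by move=> j _; rewrite coefXn ltn_eqF // scale0r.
Qed.

Fact kx_eval_monoid : monoid_morphism kx_eval.
Proof.
split=> [|p q]; first by have := kx_evalXn 0; rewrite !expr0.
have E (r : kx) : r = \sum_(i < size (r : {poly k}))
    (r : {poly k})`_i *: ('X^i : kx).
  by rewrite -[LHS]coefK poly_def.
rewrite [in LHS](E p) [in LHS](E q) mulr_suml linear_sum /=.
rewrite [in RHS]/kx_eval mulr_suml; apply: eq_bigr => i _.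
rewrite mulr_sumr linear_sum /= mulr_sumr; apply: eq_bigr => j _.
have -> : ((p : {poly k})`_i *: ('X^i : kx)) *
    ((q : {poly k})`_j *: ('X^j : kx)) =
    ((p : {poly k})`_i * (q : {poly k})`_j) *: ('X^(i + j) : kx).
  rewrite exprD -scalerA (_ : _ *: _ * _ = (p : {poly k})`_i *:
    (('X^i : kx) * ((q : {poly k})`_j *: ('X^j : kx)))) //.
    by congr (_ *: _); rewrite -[RHS]/(_ *: ('X^i * 'X^j : {poly k})) scalerAr.
  by rewrite -[RHS]/(_ *: ('X^i * (_ *: 'X^j) : {poly k})) scalerAl.
rewrite linearZ /= kx_evalXn exprD -scalerA.
by rewrite -[RHS]kalg_scaleAl; congr (_ *: _); apply: kalg_scaleAr.
Qed.

Lemma cocycleXn i : homog 0 (cocycle_val z ^+ i) /\ dgd (cocycle_val z ^+ i) = 0.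
Proof.
apply/is_cocycleP; elim: i => [|i IHi]; first exact: cocycle_one_subproof.
by rewrite exprS; exact: (cocycle_mul_subproof z (Cocycle IHi)).
Qed.

Fact kx_eval_dgc i a : kx_eval (dgc i a) = dgc i (kx_eval a).
Proof.
have h0 : dgc 0 (kx_eval a) = kx_eval a.
  rewrite linear_sum; apply: eq_bigr => j _.
  by rewrite linearZ /=; congr (_ *: _); case: (cocycleXn j).
rewrite /dgc /= -/(dgc _ _) -h0 dgc_dgc.
by case: eqP => _; rewrite ?h0 ?linear0.
Qed.

Fact kx_eval_dgd a : kx_eval (dgd a) = dgd (kx_eval a).
Proof.
rewrite [in RHS]/kx_eval !linear_sum /= big1 ?linear0 // => j _.
by rewrite linearZ /=; have [_ ->] := cocycleXn j; rewrite scaler0.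
Qed.

Definition kx_mor : dg_mor kx A :=
  DGMor kx_eval_linear kx_eval_monoid kx_eval_dgc kx_eval_dgd.

Lemma kx_morX : cohom_map kx_mor (cclass kx_var) = cclass z.
Proof.
rewrite cohom_mapE; congr cclass; apply: val_inj => /=.
exact: (kx_evalXn 1).
Qed.

End KxMor.

End Truncated.

Definition factors_through_kxn (k : fieldType) (A : dgAlg k)
    (f : ho_mor (kx k) A) (n : nat) : Prop :=
  exists g : ho_mor (kxn k n) A, ho_eq f (ho_comp g (ho_of (kx_proj k n))).

Definition nilpotent_elt (R : pzRingType) (a : R) : Prop :=
  exists m : nat, a ^+ m = 0.

(* Main.v *)
Require Import Defs.
From HB Require Import structures.
From mathcomp Require Import all_boot all_algebra.
From mathcomp Require Import boolp functions.
From mathcomp Require Import zify.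

Set Implicit Arguments.
Unset Strict Implicit.
Unset Printing Implicit Defensive.

Import GRing.Theory.
Local Open Scope ring_scope.

(* Let z = f(x) and z^m = dy.  Suppose that M is a DG bimodule over k[x]/x^n and
   A with a cocycle e such that a |-> e a is a quasi-isomorphism from A to M and
   x e is homologous to e z.  Then the triangular algebra on k[x]/x^n, M and A,
   with differential twisted by e, projects onto k[x]/x^n by a quasi-isomorphism
   and onto A by a DG morphism, and k[x] maps to it compatibly with both
   projections: this is the required factorization.

   For n >= 3m such an M is generated over A by the x^b tau_i, subject to
   x^(3m) = 0, with b >= 2m if i = 0 and b >= m if i = 1, and
     d tau_i = x^m tau_(i-1) U_i +/- x^(2m) tau_(i-2) y,
   where U_i is x - z for i odd and the sum of the x^a z^(m-1-a), a < m, for i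
   even.  Since U_(i-1) U_i = x^m - z^m and dy = z^m, the square of d sends
   tau_i to x^(3m) tau_(i-2) = 0.  The cocycle is e = x^(2m) tau_0; the leading
   terms of the U_i pair off all the other generators. *)

(** * Decompositions into homogeneous components *)

Section Support.
Variables (V : zmodType) (comp : int -> {additive V -> V}).
Hypothesis compK : forall i j a,
  comp i (comp j a) = if i == j then comp j a else 0.

Definition supported_on (s : seq int) (a : V) : Prop :=
  a = \sum_(i <- s) comp i a.

Lemma comp_out (s : seq int) (a : V) i :
  supported_on s a -> i \notin s -> comp i a = 0.
Proof.
move=> -> si; rewrite raddf_sum big_seq big1 // => j js /=.
by rewrite compK ifN //; apply: contraNneq si => ->.
Qed.

(** The components outside [s] vanish, so enlarging the index set adds only zeros. This brings
    several decompositions to a common index set. *)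
Lemma supported_onS (s t : seq int) (a : V) :
  uniq s -> uniq t -> {subset s <= t} -> supported_on s a -> supported_on t a.
Proof.
move=> us ut st sa; rewrite /supported_on [LHS]sa.
rewrite [RHS](bigID [in s]) /= [X in _ + X]big1 ?addr0; last first.
  by move=> i; apply: comp_out.
rewrite -[RHS]big_filter; apply: perm_big; apply: uniq_perm => //.
  exact: filter_uniq.
by move=> i; rewrite mem_filter; case: (boolP (i \in s)) => //= /st ->.
Qed.

End Support.

(** * DG algebras and a criterion for quasi-isomorphisms *)

Section DgAlgTheory.
Variables (k : fieldType) (A : dgAlg k).

(** The axiom [dgc_dgd] concerns homogeneous elements; decomposing [a] extends it to all
    elements. *)
Lemma dgd_dgc i (a : A) : dgc (i + 1) (dgd a) = dgd (dgc i a).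
Proof.
have [s [us ->]] := dgc_sum a.
rewrite !linear_sum /=; apply: eq_bigr => j _.
have <- : dgc (j + 1) (dgd (dgc j a)) = dgd (dgc j a).
  by apply: dgc_dgd; rewrite dgc_dgc eqxx.
rewrite !dgc_dgc (inj_eq (addIr 1)).
have [_|_] := eqVneq i j; last by rewrite linear0.
by apply: dgc_dgd; rewrite dgc_dgc eqxx.
Qed.

Lemma dgd_mul_cocycle (z b : A) : homog 0 z -> dgd z = 0 ->
  dgd (z * b) = z * dgd b.
Proof.
by move=> hz dz; rewrite (dgd_leibniz _ hz) dz mul0r add0r expr0 mul1r.
Qed.

End DgAlgTheory.

(** The kernel of [w] is acyclic, as in the long exact cohomology sequence. The hypotheses can
    ignore degrees: projecting onto one component makes lifts and primitives homogeneous. *)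
Lemma surj_acyclic_quasi_iso (k : fieldType) (B C : dgAlg k)
    (w : dg_mor B C) :
  (forall c, exists b, w b = c) ->
  (forall b, w b = 0 -> dgd b = 0 -> exists2 b', w b' = 0 & b = dgd b') ->
  quasi_iso w.
Proof.
move=> wsurj wker n.
have hsurj i c : homog i c -> exists2 b, homog i b & w b = c.
  move=> hc; have [b wb] := wsurj c; exists (dgc i b).
    by rewrite /homog dgc_dgc eqxx.
  by rewrite dgm_dgc wb.
have hker i b : homog i b -> w b = 0 -> dgd b = 0 ->
    exists b', [/\ homog (i - 1) b', w b' = 0 & b = dgd b'].
  move=> hb wb db; have [b' wb' eb] := wker _ wb db.
  exists (dgc (i - 1) b'); split.
  - by rewrite /homog dgc_dgc eqxx.
  - by rewrite dgm_dgc wb' linear0.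
  - by rewrite -dgd_dgc subrK -eb.
have inj : injective (@cohom_map _ _ _ w n).
  move=> a b; rewrite -[a]cclass_repr -[b]cclass_repr.
  move: (repr a) (repr b) => {}a {}b.
  rewrite !cohom_mapE => /cclass_eq/is_coboundaryP[c [hc eqc]].
  apply/cclass_eq/is_coboundaryP.
  have [b' hb' wb'] := hsurj _ _ hc.
  have [[ha da] [hb db]] :=
    (is_cocycleP _ _ (cocycle_valP a), is_cocycleP _ _ (cocycle_valP b)).
  (* Here [b'] lifts a primitive of w a - w b, so a - b - d b' is a cocycle of the kernel. *)
  have [] := hker n (val a - val b - dgd b').
  - rewrite /homog !linearB /= ha hb; congr (_ - _).
    by rewrite -{2}hb' -[in LHS](subrK 1 n) dgd_dgc.
  - by rewrite !linearB /= dgm_dgd wb' -eqc /= subrr.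
  - by rewrite !linearB /= da db dgd_dgd !subr0.
  move=> b'' [hb'' _ eb]; exists (b'' + b'); split.
    by rewrite /homog linearD /= hb'' hb'.
  by rewrite linearD /= -eb subrK.
have surj (c : cohom C n) : exists b, cohom_map w b = c.
  rewrite -[c]cclass_repr; move: (repr c) => {}c.
  have [hc dc] := is_cocycleP _ _ (cocycle_valP c).
  have [b hb wb] := hsurj _ _ hc.
  (* A lift [b] of the cocycle need not be closed, but d b is a cocycle of the kernel; subtracting a
     primitive of it in the kernel corrects [b]. *)
  have [] := hker (n + 1) (dgd b).
  - by rewrite /homog dgd_dgc hb.
  - by rewrite dgm_dgd wb dc.
  - exact: dgd_dgd.
  rewrite addrK => b' [hb' wb' eb].
  have zP : b - b' \in is_cocycle n.
    by apply/is_cocycleP; rewrite /homog !linearB /= hb hb' eb subrr.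
  exists (cclass (Cocycle zP)); rewrite cohom_mapE; congr cclass.
  by apply: val_inj; rewrite /= linearB /= wb wb' subr0.
have [g gK] := choice surj.
by exists g => // a; apply: inj; rewrite gK.
Qed.

(** * DG bimodules *)

(* The left algebra R is concentrated in degree 0, so its action carries no
   signs. *)
Record dgBimod (k : fieldType) (R : algType k) (A : dgAlg k) := DGBimod {
  bm_sort :> lmodType k;
  bml : R -> bm_sort -> bm_sort;
  bmr : bm_sort -> A -> bm_sort;
  bml_linear : forall r, linear (bml r);
  bml_linearl : forall u, linear (bml^~ u);
  bml1 : forall u, bml 1 u = u;
  bmlA : forall r s u, bml (r * s) u = bml r (bml s u);
  bmr_linear : forall u, linear (bmr u);
  bmr_linearl : forall a, linear (bmr^~ a);
  bmr1 : forall u, bmr u 1 = u;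
  bmrA : forall u a b, bmr u (a * b) = bmr (bmr u a) b;
  bmlr : forall r u a, bml r (bmr u a) = bmr (bml r u) a;
  bmc : int -> bm_sort -> bm_sort;
  bmc_linear : forall i, linear (bmc i);
  bmc_bmc : forall i j u, bmc i (bmc j u) = if i == j then bmc j u else 0;
  bmc_sum : forall u, exists s : seq int,
    uniq s /\ u = \sum_(i <- s) bmc i u;
  bmc_bml : forall i r u, bmc i (bml r u) = bml r (bmc i u);
  bmc_bmr : forall i j u a,
    bmc i u = u -> dgc j a = a -> bmc (i + j) (bmr u a) = bmr u a;
  bmd : bm_sort -> bm_sort;
  bmd_linear : linear bmd;
  bmc_bmd : forall i u, bmc i u = u -> bmc (i + 1) (bmd u) = bmd u;
  bmd_bmd : forall u, bmd (bmd u) = 0;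
  bmd_bml : forall r u, bmd (bml r u) = bml r (bmd u);
  bmd_bmr : forall i u a, bmc i u = u ->
    bmd (bmr u a) = bmr (bmd u) a + (-1) ^+ `|i|%N *: bmr u (dgd a)
}.

Section BimodLinear.
Variables (k : fieldType) (R : algType k) (A : dgAlg k) (M : dgBimod R A).

HB.instance Definition _ r :=
  GRing.isLinear.Build k M M *:%R (@bml _ _ _ M r) (@bml_linear _ _ _ M r).
HB.instance Definition _ u :=
  GRing.isLinear.Build k A M *:%R (@bmr _ _ _ M u) (@bmr_linear _ _ _ M u).
HB.instance Definition _ i :=
  GRing.isLinear.Build k M M *:%R (@bmc _ _ _ M i) (@bmc_linear _ _ _ M i).
HB.instance Definition _ :=
  GRing.isLinear.Build k M M *:%R (@bmd _ _ _ M) (@bmd_linear _ _ _ M).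

Let bmlv (u : M) (r : R) : M := bml r u.
HB.instance Definition _ u :=
  GRing.isLinear.Build k R M *:%R (bmlv u) (@bml_linearl _ _ _ M u).
Let bmrv (a : A) (u : M) : M := bmr u a.
HB.instance Definition _ a :=
  GRing.isLinear.Build k M M *:%R (bmrv a) (@bmr_linearl _ _ _ M a).

Lemma bml0l (u : M) : bml 0 u = 0.
Proof. exact: (linear0 (bmlv u)). Qed.
Lemma bmlDl (u : M) r s : bml (r + s) u = bml r u + bml s u.
Proof. exact: (linearD (bmlv u)). Qed.
Lemma bmlZl (u : M) c r : bml (c *: r) u = c *: bml r u.
Proof. exact: (linearZ_LR (bmlv u)). Qed.
Lemma bmr0l (a : A) : bmr 0 a = 0 :> M.
Proof. exact: (linear0 (bmrv a)). Qed.
Lemma bmrDl (u v : M) a : bmr (u + v) a = bmr u a + bmr v a.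
Proof. exact: (linearD (bmrv a)). Qed.
Lemma bmrBl (u v : M) a : bmr (u - v) a = bmr u a - bmr v a.
Proof. exact: (linearB (bmrv a)). Qed.
Lemma bmrZl c (u : M) a : bmr (c *: u) a = c *: bmr u a.
Proof. exact: (linearZ_LR (bmrv a)). Qed.

End BimodLinear.

Lemma kalg_scalerAl (k : fieldType) (A : kalg k) c (a b : A) :
  c *: (a * b) = (c *: a) * b.
Proof. exact: kalg_scaleAl. Qed.

Lemma kalg_scalerAr (k : fieldType) (A : kalg k) c (a b : A) :
  c *: (a * b) = a * (c *: b).
Proof. exact: kalg_scaleAr. Qed.

Lemma kalg_signE (k : fieldType) (A : kalg k) n (x : A) :
  (-1) ^+ n * x = (-1) ^+ n *: x.
Proof. by rewrite -!(signr_odd _ n) scaler_sign mulr_sign. Qed.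

(** * The triangular DG algebra twisted by a cocycle e *)

Section Triangular.
Variables (k : fieldType) (R : algType k) (A : dgAlg k) (M : dgBimod R A).
Variable e : M.
Hypotheses (he : bmc 1 e = e) (de : bmd e = 0).

(* Triangular matrices with diagonal (r, a) and corner u. *)
Definition tri : Type := (R * M * A)%type.
HB.instance Definition _ := GRing.Lmodule.copy tri (R * M * A)%type.

Implicit Types q : tri.

Fact tri_eq q q' : q.1.1 = q'.1.1 -> q.1.2 = q'.1.2 -> q.2 = q'.2 -> q = q'.
Proof. by case: q q' => [[r u] a] [[r' u'] a'] /= -> -> ->. Qed.

Definition tri_one : tri := (1, 0, 1).
Definition tri_mul q q' : tri :=
  (q.1.1 * q'.1.1, bml q.1.1 q'.1.2 + bmr q.1.2 q'.2, q.2 * q'.2).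

Fact tri_mulA : associative tri_mul.
Proof.
move=> [[r u] a] [[r' u'] a'] [[r'' u''] a'']; rewrite /tri_mul /=.
by congr (_, _, _); rewrite ?mulrA // linearD /= bmrDl bmlA bmrA bmlr addrA.
Qed.

Fact tri_mul1l : left_id tri_one tri_mul.
Proof.
by move=> [[r u] a]; rewrite /tri_mul /= !mul1r bml1 bmr0l addr0.
Qed.

Fact tri_mul1r : right_id tri_one tri_mul.
Proof.
by move=> [[r u] a]; rewrite /tri_mul /= !mulr1 bmr1 linear0 add0r.
Qed.

Fact tri_mulDl : left_distributive tri_mul +%R.
Proof.
move=> [[r u] a] [[r' u'] a'] [[r'' u''] a'']; rewrite /tri_mul /=.
by congr (_, _, _); rewrite ?mulrDl //= bmlDl bmrDl addrACA.
Qed.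

Fact tri_mulDr : right_distributive tri_mul +%R.
Proof.
move=> [[r u] a] [[r' u'] a'] [[r'' u''] a'']; rewrite /tri_mul /=.
by congr (_, _, _); rewrite ?mulrDr //= !linearD /= addrACA.
Qed.

HB.instance Definition _ := GRing.Zmodule_isPzRing.Build tri
  tri_mulA tri_mul1l tri_mul1r tri_mulDl tri_mulDr.

Fact tri_scaleAl c q q' : c *: (q * q') = (c *: q) * q'.
Proof.
case: q q' => [[r u] a] [[r' u'] a'].
congr (_, _, _); rewrite /= ?scalerAl //.
  by rewrite scalerDr bmlZl bmrZl.
exact: kalg_scaleAl.
Qed.

Fact tri_scaleAr c q q' : c *: (q * q') = q * (c *: q').
Proof.
case: q q' => [[r u] a] [[r' u'] a'].
congr (_, _, _); rewrite /= ?scalerAr //.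
  by rewrite scalerDr !linearZ.
exact: kalg_scaleAr.
Qed.

Definition tri_kalg : kalg k :=
  @KAlg k tri *:%R (@scalerA k tri) (@scale1r k tri) (@scalerDr k tri)
    (@scalerDl k tri) tri_scaleAl tri_scaleAr.

Definition tric (i : int) (q : tri_kalg) : tri_kalg :=
  (dgc i (q.1.1 : in_degree0 R), bmc i q.1.2, dgc i q.2).

Fact tric_linear i : linear (tric i).
Proof.
move=> c [[r u] a] [[r' u'] a'].
refine (tri_eq _ _ _) => /=.
- exact: (@dgc_linear k (in_degree0 R)).
- exact: linearP.
- exact: linearP.
Qed.

Fact tric_tric i j q : tric i (tric j q) = if i == j then tric j q else 0.
Proof.
case: q => [[r u] a]; refine (tri_eq _ _ _).
- by apply: etrans (@dgc_dgc k (in_degree0 R) i j r) _; case: eqP.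
- by apply: etrans (bmc_bmc i j u) _; case: eqP.
- by apply: etrans (dgc_dgc i j a) _; case: eqP.
Qed.

HB.instance Definition _ i :=
  GRing.isLinear.Build k tri_kalg tri_kalg *:%R (tric i) (tric_linear i).

Fact tric_sum q : exists s : seq int, uniq s /\ q = \sum_(i <- s) tric i q.
Proof.
case: q => [[r u] a].
have [s0 [us0 s0r]] := dgc_sum (r : in_degree0 R).
have [s1 [us1 s1u]] := bmc_sum u.
have [s2 [us2 s2a]] := dgc_sum a.
set s := undup (s0 ++ s1 ++ s2); exists s; split; first exact: undup_uniq.
have us : uniq s by exact: undup_uniq.
have s0s : {subset s0 <= s}.
  by move=> i si; rewrite mem_undup !mem_cat si.
have s1s : {subset s1 <= s}.
  by move=> i si; rewrite mem_undup !mem_cat si orbT.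
have s2s : {subset s2 <= s}.
  by move=> i si; rewrite mem_undup !mem_cat si !orbT.
refine (tri_eq _ _ _) => /=.
- rewrite [LHS](supported_onS (comp := @dgc k (in_degree0 R))
     (@dgc_dgc _ (in_degree0 R)) us0 us s0s s0r).
  by rewrite (big_morph (fun q : tri_kalg => (q : tri).1.1)
    (fun _ _ => erefl) erefl).
- rewrite [LHS](supported_onS (@bmc_bmc _ _ _ M) us1 us s1s s1u).
  by rewrite (big_morph (fun q : tri_kalg => (q : tri).1.2)
    (fun _ _ => erefl) erefl).
- rewrite [LHS](supported_onS (@dgc_dgc _ A) us2 us s2s s2a).
  by rewrite (big_morph (fun q : tri_kalg => (q : tri).2)
    (fun _ _ => erefl) erefl).
Qed.

Fact tric_one : tric 0 1 = 1.
Proof.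
refine (tri_eq _ _ _) => /=; last exact: dgc_one.
  exact: (@dgc_one k (in_degree0 R)).
exact: linear0.
Qed.

Lemma degree0_homog i (r : in_degree0 R) : homog i r -> i = 0 \/ r = 0.
Proof. by rewrite /homog /dgc /=; case: eqP => [|_ <-]; [left | right]. Qed.

Fact tric_mul i j q q' : tric i q = q -> tric j q' = q' ->
  tric (i + j) ((q : tri_kalg) * q') = (q : tri_kalg) * q'.
Proof.
case: q q' => [[r u] a] [[r' u'] a'].
rewrite /tric /= => -[hr hu ha] [hr' hu' ha'].
refine (tri_eq _ _ _).
- exact: (@dgc_mul k (in_degree0 R)).
- rewrite /= linearD /= bmc_bml; congr (_ + _); last exact: bmc_bmr.
  case: (degree0_homog hr) => ->; last by rewrite !bml0l.
  by rewrite add0r hu'.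
- exact: dgc_mul.
Qed.

(** The componentwise differential minus the graded commutator with the corner matrix [e] of degree
    1. No sign precedes r e because r has degree 0. *)
Definition trid (q : tri_kalg) : tri_kalg :=
  (0, bmd q.1.2 + bml q.1.1 e - bmr e q.2, dgd q.2).

Fact trid_linear : linear trid.
Proof.
move=> c [[r u] a] [[r' u'] a']; refine (tri_eq _ _ _) => /=.
- by rewrite scaler0 addr0.
- rewrite !linearP /= bmlDl bmlZl !scalerDr.
  by rewrite [X in X + _ = _]addrACA [LHS]addrACA.
- exact: dgd_linear.
Qed.

Fact tric_trid i q : tric i q = q -> tric (i + 1) (trid q) = trid q.
Proof.
case: q => [[r u] a]; rewrite /tric /= => -[hr hu ha].
refine (tri_eq _ _ _) => /=.
- exact: (linear0 (@dgc k (in_degree0 R) _)).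
- rewrite linearB linearD /= bmc_bmd // bmc_bml.
  congr (_ + _ - _); last by rewrite addrC bmc_bmr.
  by case: (degree0_homog hr) => ->; rewrite ?add0r ?he ?bml0l.
- exact: dgc_dgd.
Qed.

Fact trid_trid q : trid (trid q) = 0.
Proof.
case: q => [[r u] a]; refine (tri_eq _ _ _) => //=; last exact: dgd_dgd.
rewrite linearB linearD /= bmd_bmd bmd_bml de linear0 bml0l (bmd_bmr _ he) de.
by rewrite bmr0l expr1 scaleN1r !add0r opprK addr0 subrr.
Qed.

Fact trid_leibniz i q q' : tric i q = q ->
  trid ((q : tri_kalg) * q') =
  trid q * q' + (-1) ^+ `|i|%N * ((q : tri_kalg) * trid q').
Proof.
rewrite kalg_signE => hq.
move: hq; case: q q' => [[r u] a] [[r' u'] a'].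
rewrite /tric /= => -[hr hu ha]; refine (tri_eq _ _ _).
- by rewrite /= mulr0 scaler0 mul0r addr0.
- rewrite /= bml0l add0r linearD /= bmd_bml (bmd_bmr _ hu) bmrBl bmrDl.
  rewrite bmlA bmrA -bmlr scalerDr.
  (* A nonzero [r] forces i = 0, so the sign disappears. *)
  have -> : (-1) ^+ `|i|%N *: bml r (bmd u' + bml r' e - bmr e a') =
      bml r (bmd u') + bml r (bml r' e) - bml r (bmr e a').
    case: (degree0_homog hr) => ->; last by rewrite !bml0l scaler0 addr0 subr0.
    by rewrite expr0 scale1r linearB linearD.
  set X := bml r (bmd _); set Y := bmr (bmd u) a'; set Z := _ *: _.
  set P := bml r (bml _ _); set N := bmr (bmr _ _) _; set T := bml r (bmr e a').
  by rewrite [RHS](AC (3*4) (((4*(1*7))*5*3)*(2*6))) /= subrr addr0.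
- by rewrite [LHS](dgd_leibniz _ ha) kalg_signE.
Qed.

Definition tri_dg : dgAlg k := @DGAlg k tri_kalg tric
  tric_linear tric_tric tric_sum tric_one tric_mul trid trid_linear
  tric_trid trid_trid trid_leibniz.

Definition tri_left : dg_mor tri_dg (in_degree0 R).
Proof.
exists (fun q : tri_dg => (q : tri).1.1) => //.
Defined.

Definition tri_right : dg_mor tri_dg A.
Proof.
exists (fun q : tri_dg => (q : tri).2) => //.
Defined.

(** On the kernel of [tri_left] the differential is (v, b) |-> (d v - e b, d b); the cycle (u, a)
    stays a cycle after a boundary is subtracted. *)
Lemma bmd_subr_boundary u a v b : bmd u = bmr e a ->
  bmd (u - bmd v + bmr e b) = bmr e (a - dgd b).
Proof.
move=> du; rewrite linearD linearB /= bmd_bmd subr0 du (bmd_bmr _ he) de.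
by rewrite bmr0l add0r expr1 scaleN1r linearB.
Qed.

Lemma addr_boundary u v v' b b' :
  u - bmd v + bmr e b = bmd v' - bmr e b' ->
  u = bmd (v + v') - bmr e (b + b').
Proof.
move=> uE; rewrite !linearD /= addrACA -uE addrC -addrA.
by rewrite [bmr e b + _]addrC subrK subrK.
Qed.

(** The kernel of [tri_left] consists of the (0, u, a) and is, up to shift and signs, the cone of a
    |-> e a; the hypothesis is its exactness. *)
Lemma tri_left_quasi_iso :
  (forall u a, bmd u = bmr e a -> dgd a = 0 ->
     exists v b, u = bmd v - bmr e b /\ a = dgd b) ->
  quasi_iso tri_left.
Proof.
move=> acyc; apply: surj_acyclic_quasi_iso => [r | [[r u] a] /= ->].
  by exists ((r, 0, 0) : tri).
case=> hu ha; have [] := acyc u a; rewrite ?ha //.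
  by apply/eqP; rewrite -subr_eq0 -hu bml0l addr0.
move=> v [b [-> ->]]; exists ((0, v, b) : tri) => //.
by refine (tri_eq _ _ _) => //=; rewrite bml0l addr0.
Qed.

(** The corner [u] is a homotopy between r e and e a. Such a triple will be the image of x. *)
Fact tri_cocycle_subproof r u a : dgc 0 a = a -> dgd a = 0 ->
  bmc 0 u = u -> bmd u = bmr e a - bml r e ->
  ((r, u, a) : tri_dg) \in is_cocycle 0.
Proof.
move=> ha da hu du; apply/is_cocycleP; split; refine (tri_eq _ _ _) => //=.
by rewrite du subrK subrr.
Qed.

Definition tri_cocycle r u a ha da hu du : cocycle tri_dg 0 :=
  Cocycle (@tri_cocycle_subproof r u a ha da hu du).

End Triangular.

(** * Polynomials acting on sequences by shifts *)

Section PolyAction.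
Variables (k : fieldType) (V : lmodType k).
Implicit Types (g : nat -> V) (p q : {poly k}).

(** The value at [c] of p acting on the sequence [g], where x acts as the shift (x g)(c) = g(c +
    1). *)
Definition shift_act g (c : nat) p : V := \sum_(j < size p) p`_j *: g (c + j)%N.

Lemma shift_actE n g c p : (size p <= n)%N ->
  shift_act g c p = \sum_(j < n) p`_j *: g (c + j)%N.
Proof.
move=> pn; rewrite /shift_act.
rewrite (big_ord_widen _ (fun j => p`_j *: g (c + j)%N) pn).
rewrite big_mkcond; apply: eq_bigr => j _; case: ltnP => // hj.
by rewrite nth_default ?scale0r.
Qed.

Lemma shift_act_linear g c : linear (shift_act g c).
Proof.
move=> a p q; set n := maxn (size p) (size q).
rewrite (@shift_actE n _ _ p) ?leq_maxl // (@shift_actE n _ _ q) ?leq_maxr //.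
rewrite (@shift_actE n); last first.
  rewrite (leq_trans (size_polyD _ _)) // geq_max leq_maxr andbT.
  by rewrite (leq_trans (size_scale_leq _ _)) ?leq_maxl.
rewrite scaler_sumr -big_split /=; apply: eq_bigr => j _.
by rewrite coefD coefZ scalerDl scalerA.
Qed.

HB.instance Definition _ g c :=
  GRing.isLinear.Build k {poly k} V *:%R (shift_act g c)
    (shift_act_linear g c).

Lemma shift_actXM g p c : shift_act g c ('X * p) = shift_act g c.+1 p.
Proof.
rewrite (@shift_actE (size p).+1); last first.
  by rewrite (leq_trans (size_polyMleq _ _)) // size_polyX.
rewrite big_ord_recl coefXM eqxx scale0r add0r.
by apply: eq_bigr => j _; rewrite coefXM /= addSnnS.
Qed.

Lemma shift_actM g p q c :
  shift_act g c (p * q) = shift_act (shift_act g ^~ q) c p.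
Proof.
elim/poly_ind: p c => [|p a IHp] c; first by rewrite mul0r !linear0.
rewrite mulrDl -mulrA (mulrC p) -mulrA mul_polyC linearD /= shift_actXM.
rewrite mulrC IHp [p * 'X]mulrC linearD /= shift_actXM linearZ /=.
congr (_ + _); rewrite [RHS](@shift_actE 1) ?size_polyC_leq1 //.
by rewrite big_ord1 coefC eqxx addn0.
Qed.

Lemma shift_act1 g c : shift_act g c 1 = g c.
Proof. by rewrite /shift_act size_poly1 big_ord1 coef1 scale1r addn0. Qed.

Lemma shift_actXn g n c : shift_act g c 'X^n = g (c + n)%N.
Proof.
elim: n c => [|n IHn] c; first by rewrite expr0 shift_act1 addn0.
by rewrite exprS shift_actXM IHn addnS.
Qed.

(** A sequence that vanishes from [n] on is killed by x^n, so k[x]/x^n acts on it. *)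
Lemma shift_act_mod n g p c : (forall c', (n <= c')%N -> g c' = 0) ->
  shift_act g c (Pdiv.CommonRing.rmodp p 'X^n) = shift_act g c p.
Proof.
move=> g0; rewrite [in RHS](Pdiv.RingMonic.rdivp_eq (monicXn k n) p) linearD /=.
rewrite shift_actM [X in _ = X + _](_ : _ = 0) ?add0r //.
rewrite /shift_act big1 // => j _.
by rewrite -/(shift_act g _ _) shift_actXn g0 ?scaler0 // leq_addl.
Qed.

Lemma shift_act_lin (g h : nat -> V) a p c :
  shift_act (a *: g + h) c p = a *: shift_act g c p + shift_act h c p.
Proof.
rewrite /shift_act scaler_sumr -big_split /=; apply: eq_bigr => j _.
by rewrite [(_ + _ : nat -> V) _]/(a *: g _ + h _) scalerDr !scalerA mulrC.
Qed.

Lemma shift_act0 (b : nat) g p : (forall c, (b <= c)%N -> g c = 0) ->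
  forall c, (b <= c)%N -> shift_act g c p = 0.
Proof.
move=> g0 c bc; rewrite /shift_act big1 // => j _.
by rewrite g0 ?scaler0 // (leq_trans bc) ?leq_addr.
Qed.

End PolyAction.

Lemma shift_act_morph (k : fieldType) (V W : lmodType k) (phi : {linear V -> W})
  g p c : phi (shift_act g c p) = shift_act (fun c' => phi (g c')) c p.
Proof. by rewrite linear_sum; apply: eq_bigr => j _; rewrite linearZ. Qed.

(** * The twisted bimodule *)

Section TwistedModule.
Variables (k : fieldType) (A : dgAlg k) (m : nat).

(* [f i c] is the coefficient of x^(3m-1-c) tau_i: with this indexing x acts by
   [f i c |-> f i c.+1], without a case distinction. *)
Definition bound (i : nat) : nat := minn i.+1 3 * m.

(** Only finitely many tau_i occur, and c < [bound i] means that the exponent 3m - 1 - c is at least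
    2m for i = 0, m for i = 1 and 0 for i >= 2. *)
Definition tw_pred (f : nat -> nat -> A) : bool :=
  `[< (exists I, forall i c, (I <= i)%N -> f i c = 0) /\
      (forall i c, (bound i <= c)%N -> f i c = 0) >].

Fact tw_submod : submod_closed tw_pred.
Proof.
split=> [|a f g /asboolP[[I fI] fb] /asboolP[[J gJ] gb]]; apply/asboolP.
  by split=> //; exists 0.
have E i c : (a *: f + g) i c = a *: f i c + g i c by [].
split=> [|i c ic]; last by rewrite E fb // gb // scaler0 addr0.
exists (maxn I J) => i c; rewrite geq_max => /andP[Ii Ji].
by rewrite E fI // gJ // scaler0 addr0.
Qed.

HB.instance Definition _ :=
  GRing.isSubmodClosed.Build k (nat -> nat -> A) tw_pred tw_submod.

Record tw := Tw { twf :> nat -> nat -> A; twfP : twf \in tw_pred }.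

HB.instance Definition _ := [isSub for @twf].
HB.instance Definition _ := [Choice of tw by <:].
HB.instance Definition _ := [SubChoice_isSubLmodule of tw by <:].

Lemma tw_ext (f g : tw) : (forall i c, f i c = g i c) -> f = g.
Proof. by move=> fg; apply: val_inj; apply/funext => i; apply/funext => c. Qed.

Lemma tw_bound (f : tw) i c : (bound i <= c)%N -> f i c = 0.
Proof. by have /asboolP[_ +] := twfP f; exact. Qed.

Lemma tw_height (f : tw) : exists I, forall i c, (I <= i)%N -> f i c = 0.
Proof. by have /asboolP[+ _] := twfP f. Qed.

Lemma twP (f : nat -> nat -> A) (I : nat) :
  (forall i c, (I <= i)%N -> f i c = 0) ->
  (forall i c, (bound i <= c)%N -> f i c = 0) -> f \in tw_pred.
Proof. by move=> fI fb; apply/asboolP; split=> //; exists I. Qed.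

Lemma tw_addE (f g : tw) i c : (f + g) i c = f i c + g i c. Proof. by []. Qed.
Lemma tw_scaleE a (f : tw) i c : (a *: f) i c = a *: f i c. Proof. by []. Qed.

End TwistedModule.

(** * Actions and grading on the twisted bimodule *)

Section TwistedBimod.
Variables (k : fieldType) (A : dgAlg k) (m n : nat).
Hypotheses (m_gt0 : (0 < m)%N) (mn : (3 * m <= n)%N).
Variables (z y : A).
Hypotheses (hz : homog 0 z) (dz : dgd z = 0).
Hypotheses (hy : homog (-1) y) (dy : dgd y = z ^+ m).

Local Notation M := (tw A m).
Local Notation R := {poly %/ ('X^n : {poly k})}.

Lemma bound_le i : (bound m i <= n)%N.
Proof. by rewrite (leq_trans _ mn) // leq_mul2r geq_minr orbT. Qed.

(** Together with [boundSS], this makes the exponent conditions stable under the differential: going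
    down from tau_(i+1) to tau_i brings a factor x^m, from tau_(i+2) a factor x^(2m). *)
Lemma boundS i c : (bound m i <= c)%N -> (bound m i.+1 <= c + m)%N.
Proof. rewrite /bound; nia. Qed.

Lemma boundSS i c : (bound m i <= c)%N -> (bound m i.+2 <= c + 2 * m)%N.
Proof. rewrite /bound; nia. Qed.

Fact tw_bml_subproof (r : R) (f : M) :
  (fun i c => shift_act (f i) c (r : {poly k})) \in tw_pred m.
Proof.
have [I fI] := tw_height f.
apply: (@twP _ _ _ _ I) => i c h.
  by rewrite /shift_act big1 // => j _; rewrite fI ?scaler0.
by apply: shift_act0 h; apply: tw_bound.
Qed.
Definition tw_bml (r : R) (f : M) : M := Tw (tw_bml_subproof r f).

Fact tw_bmr_subproof (f : M) (a : A) :
  (fun i c => f i c * a) \in tw_pred m.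
Proof.
have [I fI] := tw_height f.
by apply: (@twP _ _ _ _ I) => i c h;
  [rewrite fI | rewrite tw_bound] => //; rewrite mul0r.
Qed.
Definition tw_bmr (f : M) (a : A) : M := Tw (tw_bmr_subproof f a).

Fact tw_bml_linear r : linear (tw_bml r).
Proof.
by move=> a f g; apply: tw_ext => i c; exact: (shift_act_lin (f i) (g i)).
Qed.

Fact tw_bml_linearl f : linear (tw_bml^~ f).
Proof.
by move=> a r s; apply: tw_ext => i c; exact: (shift_act_linear (f i) c a r s).
Qed.

Fact tw_bml1 f : tw_bml 1 f = f.
Proof. by apply: tw_ext => i c; apply: shift_act1. Qed.

(** The quotient type reduces modulo [mk_monic] of the given polynomial, which is x^n itself because
    n >= 3m > 0. *)
Lemma mk_monicXn : mk_monic ('X^n : {poly k}) = 'X^n.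
Proof. by rewrite mk_monic_Xn prednK // (leq_trans _ mn) // muln_gt0. Qed.

Fact tw_bmlA r s f : tw_bml (r * s) f = tw_bml r (tw_bml s f).
Proof.
apply: tw_ext => i c.
have E : (r * s : R) = Pdiv.CommonRing.rmodp ((r : {poly k}) * s) 'X^n
    :> {poly k} := congr1 _ mk_monicXn.
apply: etrans (congr1 (shift_act (f i) c) E) _.
rewrite shift_act_mod ?shift_actM //.
by move=> c' nc; apply: tw_bound; apply: leq_trans (bound_le i) nc.
Qed.

Lemma kalg_mul_linearl (a : A) : linear ( *%R^~ a : A -> A).
Proof. by move=> c u v; rewrite mulrDl kalg_scalerAl. Qed.

Lemma kalg_mul_linear (a : A) : linear ( *%R a : A -> A).
Proof. by move=> c u v; rewrite mulrDr kalg_scalerAr. Qed.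

Fact tw_bmr_linear f : linear (tw_bmr f).
Proof.
by move=> a b c; apply: tw_ext => i j; exact: (kalg_mul_linear (f i j) a b c).
Qed.

Fact tw_bmr_linearl a : linear (tw_bmr^~ a).
Proof.
move=> b f g; apply: tw_ext => i j.
exact: (kalg_mul_linearl a b (f i j) (g i j)).
Qed.

Fact tw_bmr1 f : tw_bmr f 1 = f.
Proof. by apply: tw_ext => i c /=; rewrite mulr1. Qed.

Fact tw_bmrA f a b : tw_bmr f (a * b) = tw_bmr (tw_bmr f a) b.
Proof. by apply: tw_ext => i c /=; rewrite mulrA. Qed.

Lemma shift_act_mulr (a : A) (g : nat -> A) c (p : {poly k}) :
  (shift_act g c p : A) * a = shift_act (fun c' => g c' * a : A) c p.
Proof.
pose phi := GRing.isLinear.Build k A A *:%R ( *%R^~ a) (kalg_mul_linearl a).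
pose psi : {linear A -> A} := HB.pack ( *%R^~ a : A -> A) phi.
exact: (shift_act_morph psi).
Qed.

Fact tw_bmlr r f a : tw_bml r (tw_bmr f a) = tw_bmr (tw_bml r f) a.
Proof. by apply: tw_ext => i c /=; rewrite shift_act_mulr. Qed.

(* tau_0 x^b has degree 1, so that (r, u, a) |-> d u + r e - e a preserves the
   grading of the triangular algebra. *)
Fact tw_bmc_subproof (p : int) (f : M) :
  (fun i c => dgc (p + i%:Z - 1) (f i c)) \in tw_pred m.
Proof.
have [I fI] := tw_height f.
by apply: (@twP _ _ _ _ I) => i c h;
  [rewrite fI | rewrite tw_bound] => //; rewrite linear0.
Qed.
Definition tw_bmc p (f : M) : M := Tw (tw_bmc_subproof p f).

Fact tw_bmc_linear p : linear (tw_bmc p).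
Proof. by move=> a f g; apply: tw_ext => i c /=; apply: dgc_linear. Qed.

Fact tw_bmc_bmc p q f :
  tw_bmc p (tw_bmc q f) = if p == q then tw_bmc q f else 0.
Proof.
apply: tw_ext => i c /=; rewrite dgc_dgc !(inj_eq (addIr _)).
by case: eqP.
Qed.

Lemma tw_sumE I (s : seq I) (F : I -> M) i c :
  (\sum_(j <- s) F j) i c = \sum_(j <- s) F j i c.
Proof. by elim/big_rec2: _ => // j u v _ <-. Qed.

Fact tw_bmc_sum f : exists s : seq int,
  uniq s /\ f = \sum_(p <- s) tw_bmc p f.
Proof.
have [supp suppP] := choice (@dgc_sum k A).
have [I fI] := tw_height f.
(* Nonzero coefficients have i < I and c < n; one of degree p at tau_i contributes in total degree p
   - i + 1, as tau_i has degree 1 - i. *)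
pose t := flatten [seq [seq p - i%:Z + 1 | p <- supp (f i c)]
  | i <- iota 0 I, c <- iota 0 n].
exists (undup t); split; first exact: undup_uniq.
apply: tw_ext => i c; rewrite tw_sumE /=.
have [Ii|iI] := leqP I i; first by rewrite fI // big1 // => *; rewrite linear0.
have [nc|cn] := leqP n c.
  rewrite tw_bound ?(leq_trans (bound_le i)) // big1 // => *.
  by rewrite linear0.
have [us fE] := suppP (f i c).
set u := map (fun p : int => p + i%:Z - 1) (undup t).
have uu : uniq u.
  by rewrite map_inj_uniq ?undup_uniq // => p q /addIr /addIr.
suff /(supported_onS (@dgc_dgc _ A) us uu) sub : {subset supp (f i c) <= u}.
  by rewrite [LHS](sub _ fE) big_map.
move=> p pf; apply/mapP; exists (p - i%:Z + 1); last by lia.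
rewrite mem_undup; apply/flattenP.
exists [seq q - i%:Z + 1 | q <- supp (f i c)]; last exact: map_f.
by apply: (allpairs_f (fun i c => [seq q - i%:Z + 1 | q <- supp (f i c)]));
  rewrite mem_iota.
Qed.

Fact tw_bmc_bml p r f : tw_bmc p (tw_bml r f) = tw_bml r (tw_bmc p f).
Proof. by apply: tw_ext => i c; apply: shift_act_morph. Qed.

Lemma tw_homog p (f : M) i c : tw_bmc p f = f ->
  dgc (p + i%:Z - 1) (f i c) = f i c.
Proof. by move=> {2}<-. Qed.

Fact tw_bmc_bmr p q f a : tw_bmc p f = f -> dgc q a = a ->
  tw_bmc (p + q) (tw_bmr f a) = tw_bmr f a.
Proof.
move=> hf ha; apply: tw_ext => i c /=.
have -> : p + q + i%:Z - 1 = (p + i%:Z - 1) + q by lia.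
by apply: dgc_mul => //; apply: tw_homog.
Qed.

(** * The factors U_i and the differential *)

(* [wt i a] is the coefficient of x^a in U_i. *)
Definition wt (i a : nat) : A :=
  if odd i then (if a == 0%N then - z else (a == 1%N)%:R)
  else if (a < m)%N then z ^+ (m - a.+1) else 0.

Lemma wt_cocycle i a : wt i a \in is_cocycle 0.
Proof.
have zP : z \in is_cocycle 0 by apply/is_cocycleP.
rewrite /wt; case: ifP => _; case: ifP => _; rewrite ?rpredN ?rpred0 //.
  by case: eqP => _; [apply: cocycle_one_subproof | apply: rpred0].
exact/is_cocycleP/(cocycleXn (Cocycle zP)).
Qed.

(** The part x^m tau_(i-1) U_i of d tau_i, applied to the coefficients [g] of tau_i and read at
    index [c]. The range a <= m covers the degree of U_i, which is 1 or m - 1, also when m = 1. *)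
Definition wsum (i : nat) (g : nat -> A) (c : nat) : A :=
  \sum_(a < m.+1) wt i a * g (c + m + a)%N.

Lemma wsum_odd i g c : odd i -> wsum i g c = g (c + m).+1 - z * g (c + m)%N.
Proof.
move=> oi; rewrite /wsum /wt oi big_ord_recl (bigD1 (Ordinal m_gt0)) //=.
rewrite mul1r big1 ?addr0 => [|a ha]; last first.
  rewrite (_ : (_ == 1%N) = false) ?mul0r //; apply: contraNF ha => /eqP[ha].
  exact/eqP/val_inj.
by rewrite mulNr addrC addn0 /bump /= addn1.
Qed.

Lemma wsum_even i g c : ~~ odd i ->
  wsum i g c = \sum_(a < m) z ^+ (m - a.+1) * g (c + m + a)%N.
Proof.
move=> /negPf oi; rewrite /wsum /wt oi big_ord_recr /= ltnn mul0r addr0.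
by apply: eq_bigr => a _; rewrite ltn_ord.
Qed.

(** One factor is x - z and the other is the sum of the x^a z^(m-1-a), so their product telescopes
    to x^m - z^m; the two factors x^m shift it by 2m. *)
Lemma wsum_wsum i g c :
  wsum i (wsum i.+1 g) c = g (c + 3 * m)%N - z ^+ m * g (c + 2 * m)%N.
Proof.
pose T a := z ^+ (m - a) * g (c + 2 * m + a)%N.
have -> : g (c + 3 * m)%N - z ^+ m * g (c + 2 * m)%N =
    \sum_(0 <= a < m) (T a.+1 - T a).
  rewrite telescope_sumr // /T subnn subn0 expr0 mul1r addn0.
  by congr (g _ - _); lia.
rewrite big_mkord; case: (boolP (odd i)) => oi.
  rewrite wsum_odd // !wsum_even /= ?oi //.
  rewrite mulr_sumr -sumrB; apply: eq_bigr => a _.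
  rewrite mulrA -exprS /T; have am := ltn_ord a.
  by congr (_ * g _ - z ^+ _ * g _); lia.
rewrite wsum_even //; apply: eq_bigr => a _; rewrite wsum_odd /= ?oi //.
rewrite mulrBr mulrA -exprSr /T; have am := ltn_ord a.
by congr (_ * g _ - z ^+ _ * g _); lia.
Qed.

Lemma wsum_linear i (g h : nat -> A) b c :
  wsum i (b *: g + h) c = b *: wsum i g c + wsum i h c.
Proof.
rewrite /wsum scaler_sumr -big_split /=; apply: eq_bigr => a _.
exact: kalg_mul_linear.
Qed.

Lemma wsum_dgd i (g : nat -> A) c :
  dgd (wsum i g c) = wsum i (fun c => dgd (g c)) c.
Proof.
rewrite /wsum linear_sum; apply: eq_bigr => a _.
by have [hw dw] := is_cocycleP _ _ (wt_cocycle i a); apply: dgd_mul_cocycle.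
Qed.

(** The coefficient at tau_i: the sign (-1)^(i+1) before the differential of A is the Koszul sign of
    tau_i, while the terms in [y] and [wsum] come from d tau_(i+2) and d tau_(i+1). *)
Definition twdiff (f : nat -> nat -> A) (i c : nat) : A :=
  (-1) ^+ i.+1 *: (dgd (f i c) + y * f i.+2 (c + 2 * m)%N)
  + wsum i.+1 (f i.+1) c.

Lemma twdiff_linear : linear twdiff.
Proof.
move=> b f g; apply/funext => i; apply/funext => c.
rewrite [LHS]/twdiff.
have E j l : (b *: f + g) j l = b *: f j l + g j l by [].
rewrite !E (wsum_linear _ (f i.+1) (g i.+1)) linearP /=.
have -> : y * (b *: f i.+2 (c + 2 * m)%N + g i.+2 (c + 2 * m)%N) =
  b *: (y * f i.+2 (c + 2 * m)%N) + y * g i.+2 (c + 2 * m)%N.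
  exact: kalg_mul_linear.
have -> : (b *: twdiff f + twdiff g) i c = b *: twdiff f i c + twdiff g i c.
  by [].
rewrite [X in _ *: X + _]addrACA -scalerDr [(-1) ^+ _ *: _]scalerDr scalerA.
by rewrite [_ * b]mulrC -scalerA addrACA -scalerDr.
Qed.

HB.instance Definition _ :=
  GRing.isLinear.Build k (nat -> nat -> A) (nat -> nat -> A) *:%R twdiff
    twdiff_linear.

Lemma twdiff_shift j (f : nat -> nat -> A) i c :
  twdiff (fun i c => f i (c + j)%N) i c = twdiff f i (c + j)%N.
Proof.
rewrite /twdiff addnAC; congr (_ + _); apply: eq_bigr => a _.
by congr (_ * f _ _); lia.
Qed.

Fact tw_bmd_subproof (f : M) : twdiff f \in tw_pred m.
Proof.
have [I fI] := tw_height f.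
apply: (@twP _ _ _ _ I) => i c h; rewrite /twdiff /wsum.
  rewrite !fI ?(leq_trans h) // 1?ltnW // mulr0 linear0 addr0 scaler0 add0r.
  by rewrite big1 // => a _; rewrite fI ?mulr0 // (leq_trans h).
rewrite !tw_bound ?boundSS // mulr0 linear0 addr0 scaler0 add0r.
rewrite big1 // => a _; rewrite tw_bound ?mulr0 //.
by rewrite (leq_trans (boundS h)) ?leq_addr.
Qed.
Definition tw_bmd (f : M) : M := Tw (tw_bmd_subproof f).

Fact tw_bmd_linear : linear tw_bmd.
Proof. by move=> b f g; apply: val_inj; exact: (twdiff_linear b f g). Qed.

Lemma wt_mul_homog i a j (u : A) :
  homog j u -> homog j (wt i a * u).
Proof.
have [hw _] := is_cocycleP _ _ (wt_cocycle i a).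
by move=> hu; rewrite /homog -{1}[j]add0r; apply: dgc_mul.
Qed.

Fact tw_bmc_bmd p f : tw_bmc p f = f -> tw_bmc (p + 1) (tw_bmd f) = tw_bmd f.
Proof.
move=> hf; apply: tw_ext => i c /=; rewrite /twdiff linearD linearZ linearD /=.
congr (_ *: (_ + _) + _).
- have -> : p + 1 + i%:Z - 1 = p + i%:Z - 1 + 1 by lia.
  by rewrite dgd_dgc (tw_homog _ _ hf).
- have -> : p + 1 + i%:Z - 1 = -1 + (p + i.+2%:Z - 1) by lia.
  by apply: dgc_mul => //; apply: tw_homog.
- rewrite linear_sum; apply: eq_bigr => a _ /=; apply: wt_mul_homog.
  have -> : p + 1 + i%:Z - 1 = p + i.+1%:Z - 1 by lia.
  exact: tw_homog.
Qed.

Lemma bound3m i c : (3 * m <= c)%N -> (bound m i <= c)%N.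
Proof. by rewrite /bound; nia. Qed.

Lemma dgd_ymul (u : A) : dgd (y * u) = z ^+ m * u - y * dgd u.
Proof. by rewrite (dgd_leibniz _ hy) dy expr1 mulN1r. Qed.

Fact tw_bmd_bmd f : tw_bmd (tw_bmd f) = 0.
Proof.
apply: tw_ext => i c /=; rewrite {1}/twdiff.
set u := f i.+2 (c + 2 * m)%N; set s := (-1) ^+ i.+1.
(* The other terms involve indices at least 3m, where all coefficients vanish. *)
have E3 : twdiff f i.+2 (c + 2 * m) = s *: dgd u.
  rewrite /twdiff /wsum big1 ?addr0 => [|a _]; last first.
    by rewrite tw_bound ?mulr0 // bound3m //; lia.
  rewrite [f i.+4 _]tw_bound ?mulr0 ?addr0 ?bound3m //; last by lia.
  by rewrite [_ ^+ i.+3]exprS [_ ^+ i.+2]exprS !mulN1r opprK.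
(* Two consecutive factors give x^(3m) - z^m x^(2m) by [wsum_wsum], and the part in x^(3m)
   vanishes. *)
have E4 : wsum i.+1 (twdiff f i.+1) c =
    - s *: wsum i.+1 (fun c => dgd (f i.+1 c)) c - z ^+ m * u.
  transitivity (wsum i.+1 ((- s) *: (fun c => dgd (f i.+1 c)) +
      wsum i.+2 (f i.+2)) c).
    apply: eq_bigr => a _; congr (_ * _); rewrite {1}/twdiff.
    rewrite [f i.+3 _]tw_bound ?mulr0 ?addr0 ?bound3m //; last by lia.
    by rewrite exprS mulN1r.
  rewrite wsum_linear wsum_wsum; congr (_ + _).
  by rewrite [f i.+2 (_ + 3 * _)%N]tw_bound ?sub0r ?bound3m // leq_addl.
(* The relation d y = z^m yields the term that cancels z^m u in [E4]. *)
have E1 : dgd (twdiff f i c) = s *: (z ^+ m * u - y * dgd u) +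
    wsum i.+1 (fun c => dgd (f i.+1 c)) c.
  rewrite /twdiff linearD /= wsum_dgd; congr (_ + _).
  rewrite linearZ /=; congr (_ *: _).
  by rewrite linearD /= dgd_dgd add0r dgd_ymul.
have ss : s * s = 1 by rewrite -expr2 sqrr_sign.
have E2 : y * (s *: dgd u) = s *: (y * dgd u) by rewrite kalg_scalerAr.
rewrite E3 E4 E1 E2 !scalerDr !scalerA ss !scale1r scaleNr.
set Z := z ^+ m * u; set V := s *: _; set Y := y * _.
by rewrite [X in X + _]addrAC subrK addrA addrK subrr.
Qed.

(** The action of [r] is a linear combination of shifts in c, and [twdiff] commutes with each of
    them. *)
Fact tw_bmd_bml r f : tw_bmd (tw_bml r f) = tw_bml r (tw_bmd f).
Proof.
have E : (tw_bml r f : nat -> nat -> A) =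
    \sum_(j < size (r : {poly k})) (r : {poly k})`_j *:
      (fun i c => f i (c + j)%N : A).
  apply/funext => i; apply/funext => c; rewrite /= /shift_act.
  by elim/big_rec2: _ => // j u v _ ->.
apply: val_inj; rewrite [LHS](congr1 twdiff E) linear_sum.
apply/funext => i; apply/funext => c; rewrite /shift_act.
transitivity (\sum_(j < size (r : {poly k})) (r : {poly k})`_j *:
  twdiff (fun i c => f i (c + j)%N : A) i c).
  by elim/big_rec2: _ => // j u v _ <-; rewrite linearZ.
by apply: eq_bigr => j _; rewrite twdiff_shift.
Qed.

Fact tw_bmd_bmr p f a : tw_bmc p f = f ->
  tw_bmd (tw_bmr f a) =
  tw_bmr (tw_bmd f) a + (-1) ^+ `|p|%N *: tw_bmr f (dgd a).
Proof.
move=> hf; apply: tw_ext => i c; rewrite tw_addE tw_scaleE /= /twdiff.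
rewrite (dgd_leibniz _ (tw_homog i c hf)) kalg_signE mulrA mulrDl /wsum.
rewrite mulr_suml.
rewrite -kalg_scalerAl mulrDl [X in _ *: X + _]addrAC scalerDr scalerA.
rewrite addrAC; congr (_ + _ + _ *: _).
  by apply: eq_bigr => j _; rewrite mulrA.
(* The coefficient at tau_i has degree p + i - 1, and (i + 1) + (p + i - 1) has the parity of p. *)
rewrite -exprD -signr_odd -[RHS]signr_odd; congr (_ ^+ nat_of_bool _); lia.
Qed.

Definition tw_bimod : dgBimod R A := @DGBimod k R A M tw_bml tw_bmr
  tw_bml_linear tw_bml_linearl tw_bml1 tw_bmlA tw_bmr_linear tw_bmr_linearl
  tw_bmr1 tw_bmrA tw_bmlr tw_bmc tw_bmc_linear tw_bmc_bmc tw_bmc_sum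
  tw_bmc_bml tw_bmc_bmr tw_bmd tw_bmd_linear tw_bmc_bmd tw_bmd_bmd
  tw_bmd_bml tw_bmd_bmr.

(** * The cocycle e and the homotopy between x e and e z *)

Lemma dgd1 : dgd (1 : A) = 0.
Proof. by have /is_cocycleP[] := cocycle_one_subproof A. Qed.

Fact tw_single_subproof i0 c0 : (c0 < bound m i0)%N ->
  (fun i c => if (i == i0) && (c == c0) then 1 else 0 : A) \in tw_pred m.
Proof.
move=> h0; apply: (@twP _ _ _ _ i0.+1) => i c h;
  case: ifP => // /andP[/eqP ii0 /eqP cc0].
  by move: h; rewrite ii0 ltnn.
by move: h0; rewrite -ii0 -cc0 ltnNge h.
Qed.
Definition tw_single i0 c0 (h : (c0 < bound m i0)%N) : M :=
  Tw (tw_single_subproof h).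

Fact unit_subproof : (m.-1 < bound m 0)%N.
Proof. rewrite /bound; lia. Qed.
(** The cocycle e = x^(2m) tau_0: index m - 1 stands for the exponent 3m - 1 - (m - 1) = 2m. *)
Definition tw_unit : tw_bimod := tw_single unit_subproof.

Fact htpy_subproof : (m + m.-1 < bound m 1)%N.
Proof. rewrite /bound; lia. Qed.
(* x^m tau_1, whose boundary is x e - e z. *)
Definition tw_htpy : tw_bimod := tw_single htpy_subproof.

Lemma tw_unit_homog : bmc 1 tw_unit = tw_unit.
Proof.
apply: tw_ext => i c /=; case: ifP => [/andP[/eqP-> _]|_]; rewrite ?linear0 //.
exact: dgc_one.
Qed.

Lemma tw_htpy_homog : bmc 0 tw_htpy = tw_htpy.
Proof.
apply: tw_ext => i c /=; case: ifP => [/andP[/eqP-> _]|_]; rewrite ?linear0 //.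
exact: dgc_one.
Qed.

Lemma dgd_if (b : bool) : dgd (if b then 1 else 0 : A) = 0.
Proof. by case: b; rewrite ?dgd1 ?linear0. Qed.

Lemma tw_unit_closed : bmd tw_unit = 0.
Proof.
apply: tw_ext => i c /=; rewrite /twdiff dgd_if /= mulr0 addr0 scaler0 add0r.
by rewrite /wsum big1 // => a _; rewrite mulr0.
Qed.

(** Since U_1 = x - z, the boundary of x^m tau_1 is x^(2m) tau_0 (x - z). *)
Lemma bmd_tw_htpy :
  bmd tw_htpy = bml (in_qpoly ('X^n : {poly k}) 'X) tw_unit - bmr tw_unit z.
Proof.
apply: tw_ext => i c.
have Ex : bml (in_qpoly ('X^n : {poly k}) 'X) tw_unit i c = tw_unit i c.+1.
  have E : in_qpoly ('X^n : {poly k}) 'X = Pdiv.CommonRing.rmodp 'X 'X^n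
    :> {poly k} := congr1 _ mk_monicXn.
  apply: etrans (congr1 (shift_act (tw_unit i) c) E) _.
  rewrite shift_act_mod ?(shift_actXn _ 1) ?addn1 // => c' nc.
  by apply: tw_bound; apply: leq_trans (bound_le i) nc.
transitivity (tw_unit i c.+1 - tw_unit i c * z); last by rewrite -Ex.
rewrite [LHS]/(twdiff tw_htpy i c) /twdiff dgd_if /= !mulr0 addr0 scaler0 add0r.
case: i {Ex} => [|i] /=; last first.
  by rewrite /wsum big1 ?mul0r ?subr0 // => a _; rewrite mulr0.
rewrite wsum_odd //=; congr (_ - _); first by congr (if _ then _ else _); lia.
have -> : (c + m == m + m.-1)%N = (c == m.-1) by lia.
by case: ifP; rewrite ?mulr1 ?mul1r ?mulr0 ?mul0r.
Qed.

(** * Acyclicity: cancelling generators in pairs by leading terms *)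

(* The degree in x of U_i, which is monic. *)
Definition lead (i : nat) : nat := if odd i then 1 else m.-1.

Lemma leadD i : (lead i + lead i.+1 = m)%N.
Proof. by rewrite /lead /=; case: odd => /=; lia. Qed.

(** U_i is monic of degree [lead i]: the lower terms meet zeros of [g], and there are no higher
    ones. *)
Lemma wsum_lead i g c :
  (forall a, (a < lead i)%N -> g (c + m + a)%N = 0) ->
  wsum i g c = g (c + m + lead i)%N.
Proof.
move=> g0; have lm : (lead i < m.+1)%N by have := leadD i; lia.
rewrite /wsum (bigD1 (Ordinal lm)) //= big1 => [|a ha].
  rewrite addr0 /wt /lead; case: (odd i) => /=; first by rewrite mul1r.
  by rewrite prednK // leqnn subnn expr0 mul1r.
have {}ha : (a : nat) <> lead i by move=> E; case/eqP: ha; apply: val_inj.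
have [/g0-> | la] := ltnP a (lead i); first by rewrite mulr0.
rewrite /wt; move: ha la; rewrite /lead; case: (odd i) => ha la.
  have /negPf-> : (a != 0 :> nat)%N by lia.
  have /negPf-> : (a != 1 :> nat)%N by lia.
  by rewrite mul0r.
by rewrite ifN ?mul0r //; lia.
Qed.

(* Subtracting the boundary of [tw_htpy_op u] from a cycle u removes its leading
   term for the lexicographic order of (i, b), which [tw_rank] encodes. *)
Definition tw_rank (i c : nat) : nat := i * (3 * m) + (3 * m - c.+1).

(** Sends x^b tau_j to x^(b - m - lead(j+1)) tau_(j+1) when the latter is a generator, and to 0
    otherwise: this inverts the leading term of d tau_(j+1). *)
Fact tw_htpy_op_subproof (u : M) :
  (fun i c => if i isn't j.+1 then 0 else
     if (m + lead i <= c < bound m i)%N then u j (c - (m + lead i))%N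
     else 0 : A) \in tw_pred m.
Proof.
have [I uI] := tw_height u.
apply: (@twP _ _ _ _ I.+1) => [[|i] c h|[|i] c h] //.
  by rewrite uI ?if_same.
by rewrite [(c < _)%N]ltnNge h andbF.
Qed.
Definition tw_htpy_op (u : M) : M := Tw (tw_htpy_op_subproof u).

(** A generator at tau_i other than e either is the leading term of the boundary of a generator at
    tau_(i+1), or has a boundary whose leading term lies at tau_(i-1). In the first case the
    boundary of [tw_htpy_op u] reproduces its coefficient; in the second the cycle equation
    expresses it by the differential of its partner's coefficient. *)
Lemma tw_rank_lower (u : tw_bimod) (a : A) (s : nat) :
  bmd u = bmr tw_unit a ->
  (forall i c, (c < bound m i)%N -> (s < tw_rank i c)%N -> u i c = 0) ->
  forall i c, (c < bound m i)%N -> (s <= tw_rank i c)%N ->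
    u i c = twdiff (tw_htpy_op u) i c + tw_unit i c * u 0%N m.-1.
Proof.
move=> du us i c ci sic.
(* A smaller index c is a larger exponent of x, hence a larger rank. *)
have uhigh i' c' : (i < i')%N || (i' == i) && (c' < c)%N -> u i' c' = 0.
  move=> h; have [b|b] := ltnP c' (bound m i'); last exact: tw_bound.
  apply: us => //; apply: leq_ltn_trans sic _.
  by move: h b ci; rewrite /tw_rank /bound; nia.
set v := tw_htpy_op u.
have v2 : v i.+2 (c + 2 * m)%N = 0.
  by rewrite /= uhigh ?ltnSn ?if_same.
have v1 : wsum i.+1 (v i.+1) c =
    if (c + m + lead i.+1 < bound m i.+1)%N then u i c else 0.
  rewrite wsum_lead => [|b hb] /=.
    by rewrite -addnA leq_addl addnK /=.
  case: ifP => // /andP[h _]; rewrite uhigh //; apply/orP; right; lia.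
rewrite /twdiff -/v v2 v1 mulr0 addr0.
case: i ci sic uhigh v2 v1 => [|j] ci sic uhigh _ _; rewrite /v /=.
  (* At i = 0 the index m - 1 is e, which has no partner; all the others are leading terms coming
     from tau_1. *)
  rewrite linear0 scaler0 add0r /lead /bound /=.
  have [->|cm] := eqVneq c m.-1; first by rewrite ifF ?mul1r ?add0r //; lia.
  by rewrite mul0r addr0 ifT //; move: ci; rewrite /bound; lia.
have lj := leadD j.+1; rewrite mul0r addr0.
have [lc|lc] /= := leqP (m + lead j.+1) c; last first.
  rewrite linear0 scaler0 add0r ifT //; move: lc lj ci; rewrite /bound; nia.
rewrite ci [X in _ + X]ifF; last by move: lc lj ci; rewrite /bound; nia.
set l := (c - (m + lead j.+1))%N.
(* The cycle equation at the partner (j, l): by rank only d (u j l) and the leading term u i c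
   remain in it, so u i c is determined up to sign. *)
have : twdiff u j l = tw_unit j l * a := congr1 (fun f : M => f j l) du.
have -> : tw_unit j l = 0.
  rewrite /= ifF //; apply/negP => /andP[/eqP j0 /eqP lE].
  by move: lc ci lE; rewrite /l /lead /bound j0 /=; lia.
rewrite mul0r /twdiff [u j.+2 _]uhigh ?ltnSn // mulr0 addr0 wsum_lead.
  have -> : (l + m + lead j.+1 = c)%N by rewrite /l; lia.
  move/eqP; rewrite addrC addr_eq0 => /eqP->.
  by rewrite [(-1) ^+ j.+2]exprS mulN1r scaleNr addr0.
by move=> b hb; apply: uhigh; apply/orP; right; rewrite eqxx /l; lia.
Qed.

(** Induction on a bound for the ranks that occur in [u]; each step subtracts the boundary of a pair
    (v, b) and lowers the bound by one. *)
Lemma tw_unit_acyclic (u : tw_bimod) (a : A) :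
  bmd u = bmr tw_unit a -> dgd a = 0 ->
  exists v b, u = bmd v - bmr tw_unit b /\ a = dgd b.
Proof.
have [s us] : exists s, forall i c, (c < bound m i)%N ->
    (s <= tw_rank i c)%N -> u i c = 0.
  (* A rank of at least 3mI forces i >= I, because 3m - 1 - c < 3m. *)
  have [I uI] := tw_height u; exists (I * (3 * m))%N => i c ci h.
  by apply: uI; move: ci h; rewrite /bound /tw_rank; nia.
elim: s u a us => [|s IHs] u a us du da.
  have u0 : u = 0.
    apply: tw_ext => i c; have [ci|] := ltnP c (bound m i); first exact: us.
    exact: tw_bound.
  exists 0, 0; rewrite u0 !linear0 addr0; split=> //.
  (* Now e a = d u = 0, and the coefficient of e at (0, m - 1) is 1, so a = 0. *)
  have : tw_unit 0%N m.-1 * a = 0.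
    by rewrite -[LHS]/((bmr tw_unit a : M) 0%N m.-1) -du u0 linear0.
  by rewrite /= eqxx mul1r.
(* The coefficient of e is removed through the component in A, by the term e b. *)
set b := - u 0%N m.-1; set v : tw_bimod := tw_htpy_op u.
have [||| v' [b' [uE aE]]] := IHs (u - bmd v + bmr tw_unit b) (a - dgd b).
- move=> i c ci si; have := tw_rank_lower du us ci si.
  have -> : (u - bmd v + bmr tw_unit b : M) i c =
    u i c - twdiff v i c + tw_unit i c * b by [].
  by move=> ->; rewrite [X in X - _]addrC addrK /b mulrN subrr.
- exact: (bmd_subr_boundary tw_unit_homog tw_unit_closed).
- by rewrite linearB /= da dgd_dgd subr0.
exists (v + v'), (b + b'); split; first exact: addr_boundary.
by rewrite linearD /= -aE addrC subrK.
Qed.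

End TwistedBimod.

(** * Factorization in the homotopy category *)

Lemma kx_mor_ext (k : fieldType) (A : dgAlg k) (f g : dg_mor (kx k) A) :
  f ('X : {poly k}) = g ('X : {poly k}) -> f = g.
Proof.
move=> fg; apply: dg_mor_ext => p.
have -> : p = \sum_(i < size (p : {poly k}))
    (p : {poly k})`_i *: ('X : kx k) ^+ i.
  by rewrite -[LHS]coefK poly_def.
rewrite !linear_sum; apply: eq_bigr => i _.
rewrite !linearZ /= !rmorphXn; exact: (congr1 (fun u : A => _ *: u ^+ i) fg).
Qed.

Lemma factors_through_kxn_of_power (k : fieldType) (A : dgAlg k)
    (f : dg_mor (kx k) A) (m n : nat) (y : A) :
  (0 < m)%N -> (3 * m <= n)%N -> homog (-1) y ->
  dgd y = f ('X : {poly k}) ^+ m -> factors_through_kxn (ho_of f) n.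
Proof.
move=> m_gt0 mn hy dy.
have [hz dz] : homog 0 (f ('X : {poly k})) /\ dgd (f ('X : {poly k})) = 0.
  exact/is_cocycleP/(cocycle_map_subproof f (kx_var k)).
pose he := tw_unit_homog m_gt0 mn hz dz hy dy.
pose de := tw_unit_closed m_gt0 mn hz dz hy dy.
have qw : quasi_iso (tri_left he de).
  by apply: tri_left_quasi_iso; apply: tw_unit_acyclic.
(* The corner is minus x^m tau_1, whose boundary e z - x e is the one [tri_cocycle] requires. *)
have hu := etrans (linearN _ _)
  (congr1 -%R (tw_htpy_homog m_gt0 mn hz dz hy dy)).
have du := etrans (linearN _ _) (etrans
  (congr1 -%R (bmd_tw_htpy m_gt0 mn hz dz hy dy)) (opprB _ _)).
(* The morphism from k[x] that sends x to (x mod x^n, - x^m tau_1, z). *)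
pose s := kx_mor (tri_cocycle he de hz dz hu du).
have sX : s ('X : {poly k}) = tri_cocycle he de hz dz hu du.
  exact: (kx_evalXn _ 1).
have ws : dg_comp (tri_left he de) s = kx_proj k n.
  apply: kx_mor_ext; exact: (congr1 (tri_left he de) sX).
have fs : dg_comp (tri_right he de) s = f.
  apply: kx_mor_ext; exact: (congr1 (tri_right he de) sX).
(* The projection is [tri_left] after [s] and f is [tri_right] after [s], so inverting [tri_left]
   gives the factor. *)
exists (ho_comp (ho_of (tri_right he de)) (ho_inv qw)).
rewrite -{1}fs -ws.
apply: ho_trans (ho_of_comp _ _) _.
apply: ho_trans (ho_assoc _ _ _).
apply: ho_congr; first exact: ho_refl.
apply: ho_trans (ho_congr (ho_refl _) (ho_sym (ho_of_comp _ _))).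
apply: ho_trans (ho_sym (ho_assoc _ _ _)).
apply: ho_trans (ho_congr (ho_sym (ho_inv_l _)) (ho_refl _)).
exact/ho_sym/ho_idl.
Qed.

Lemma cclassX (k : fieldType) (A : dgAlg k) (c : cocycle A 0) m :
  exists2 c' : cocycle A 0, (cclass c : H0 A) ^+ m = cclass c' &
    val c' = val c ^+ m.
Proof.
elim: m => [|m [c' cE c'E]]; first by exists (cocycle_one A).
exists (cocycle_mul c c'); last by rewrite exprS /= c'E.
by rewrite exprS cE; apply: H0_mulE.
Qed.

(** A vanishing power a^m means that f(x)^m is the differential of some y of degree -1. *)
Lemma factors_through_kxn_of_nilpotent (k : fieldType) (A : dgAlg k)
    (a : H0 A) (f : dg_mor (kx k) A) (m n : nat) :
  (0 < m)%N -> (3 * m <= n)%N -> a ^+ m = 0 ->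
  cohom_map f (cclass (kx_var k)) = a -> factors_through_kxn (ho_of f) n.
Proof.
move=> m_gt0 mn am; rewrite cohom_mapE => aE.
have [c cE cv] := cclassX (cocycle_map f (kx_var k)) m.
have /cclass_eq/is_coboundaryP[y [hy dy]] : cclass c = cclass (0 : cocycle A 0).
  by rewrite -cE [cclass _]aE am; apply/esym/(raddf0 (\pi_(cohom A 0))%qT).
apply: (factors_through_kxn_of_power m_gt0 mn (y := y)) => //.
by rewrite -dy subr0 cv.
Qed.

Theorem theorem6p3 (k : fieldType) :
  (forall (A : dgAlg k) (a : H0 A) (f : dg_mor (kx k) A),
     nilpotent_elt a -> cohom_map f (cclass (kx_var k)) = a ->
     exists N : nat, forall n : nat, (N <= n)%N ->
       factors_through_kxn (ho_of f) n)
  /\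
  (forall (A : dgAlg k) (a : H0 A) (f : dg_mor (kx k) A),
     a ^+ 2 = 0 -> cohom_map f (cclass (kx_var k)) = a ->
     factors_through_kxn (ho_of f) 6).
Proof.
(* For a^2 = 0 the bound 3m with m = 2 is 6. *)
split=> [A a f [m am] fa | A a f]; last exact: factors_through_kxn_of_nilpotent.
(* The exponent m may be 0, when H^0(A) = 0; m + 1 is positive and still kills a. *)
exists (3 * m.+1)%N => n mn.
apply: (factors_through_kxn_of_nilpotent _ mn _ fa) => //.
by rewrite exprS am mulr0.
Qed.
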